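(* (Fejér inequality) Let $a<b$ be real numbers, let $f : [a,b] \to X$ be a uniformly differentiable and convex function and let $w:[a,b] \to [0,+\infty[$ be a uniformly continuous map such that $w(a+t) = w(b-t)$ for every $0 \leq t \leq \dfrac{b-a}{2}$. Then $$f\Bigl( \dfrac{a+b}{2} \Bigr) \int_a^b w(t)\, d\mu(t) \leq \int_a^b f(t)w(t)\, d\mu(t) \leq \dfrac{f(a)+f(b)}{2} \int_a^b w(t)\, d\mu(t),$$ where $\mu$ is the Lebesgue measure on $[a,b]$.
   Context: Setting. $X$ is a Dedekind complete vector lattice with an order unit $e$ (for every $x\in X$ there is a real $c>0$ with $|x|\le c e$). By the Maeda-Ogasawara-Vulikh theorem $X$ is lattice isomorphic to $C(\Omega)$, $\Omega$ compact and extremely disconnected, with $e$ corresponding to the constant function $1$; $X$ carries the corresponding pointwise multiplication, so it is a commutative $f$-algebra with unit $e$. $X^+$ denotes the set of elements $x\ge 0$, $x\neq 0$, and $\mathbb{R}^+=]0,+\infty[$. An $(o)$-sequence (in $X$ or $\mathbb{R}$) is a decreasing sequence with infimum $0$. Uniform differentiability: $f:[a,b]\to X$ is uniformly differentiable iff there are a bounded $g:[a,b]\to X$ (the uniform derivative of $f$) and $(o)$-sequences $(\sigma_p)_p$ in $X$, $(\delta_p)_p$ in $\mathbb{R}^+$ with $$\bigvee\Bigl\{\Bigl|\frac{f(v)-f(u)}{v-u}-g(x)\Bigr|:u\le x\le v,\ 0<v-u\le\delta_p\Bigr\}\le\sigma_p e\quad\text{for every }p\in\mathbb{N},$$ where $u,x,v\in[a,b]$.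 Convexity: $f:[a,b]\to X$ is convex iff $f(t)\le f(t_1)+\frac{f(t_2)-f(t_1)}{t_2-t_1}(t-t_1)$ whenever $t_1<t<t_2$ are in $[a,b]$. For the real-valued map $w$, uniform continuity is the usual one. Integral: put $G=[a,b]$, $\mathcal{A}$ the Lebesgue measurable subsets of $G$, $\mu$ the Lebesgue measure, $\mathcal{A}_b=\{B\in\mathcal{A}:\mu(B)<+\infty\}$, and let $\mathcal{F}$ be a fixed free filter of $\mathbb{N}$, i.e. a filter of subsets of $\mathbb{N}$ (not containing $\emptyset$) containing all cofinite sets. $(o_{\mathcal F})\lim_n x_n=x$ in $X$ means that there is an $(o)$-sequence $(\sigma_p)_p$ in $X$ with $\{n:|x_n-x|\le\sigma_p\}\in\mathcal{F}$ for every $p$. A function $f:G\to X$ is simple iff it has finite range and $f^{-1}(\{x\})\in\mathcal{A}$ for every $x\in X$. $L^*$ is the set of simple functions vanishing outside a set of finite measure; for $f=\sum_i c_i 1_{E_i}\in L^*$ (with the $E_i\in\mathcal{A}_b$ pairwise disjoint), $\int_G f\,d\mu=\sum_i c_i\mu(E_i)$ and $\int_A f\,d\mu=\int_G f1_A\,d\mu$ for $A\in\mathcal{A}$. Put $\iota(f)=\int_G|f|\,d\mu$ for $f\in L^*$. A sequence $(f_n)_n$ in $X^G$ $\mu$-converges to $f\in X^G$ iff there are $(o)$-sequences $(\varepsilon_p)_p$, $(\sigma_p)_p$ in $\mathbb{R}^+$ and sets $A_n^p\in\mathcal{A}$ with $A_n^p\supset\{t\in G:|f_n(t)-f(t)|\not\le\varepsilon_p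 e\}$ for all $n,p$ and $\{n:\mu(A_n^p)\le\sigma_p\}\in\mathcal{F}$ for all $p$. A sequence $(f_n)_n$ in $L^*$ is equi-absolutely continuous iff there is a real $\alpha>0$ such that: (1) for every $(o)$-sequence $(\sigma_p)_p$ in $\mathbb{R}^+$ there are an $(o)$-sequence $(w_p)_p$ in $X^+$ and sets $\Lambda^p\in\mathcal{F}$ with $\iota(\alpha f_n1_B)\le w_p$ whenever $n\in\Lambda^p$, $B\in\mathcal{A}$, $\mu(B)\le\sigma_p$; (2) there are an $(o)$-sequence $(r_m)_m$ in $X^+$ and sets $B_m\in\mathcal{A}_b$ with $\{n:\iota(\alpha f_n1_{G\setminus B_m})\le r_m\}\in\mathcal{F}$ for every $m$. A positive $f:G\to X$ is integrable iff there are an equi-absolutely continuous sequence $(f_n)_n$ in $L^*$, $\mu$-convergent to $f$, and a map $l:\mathcal{A}\to X$ with $(o_{\mathcal F})\lim_n\bigvee_{A\in\mathcal{A}}|\int_A f_n\,d\mu-l(A)|=0$; then $\int_A f\,d\mu:=l(A)$ (independent of the sequence). A general $f:G\to X$ is integrable iff $f\vee0$ and $(-f)\vee0$ are, and its integral is the difference of the two integrals. $\int_a^b f\,d\mu$ means $\int_{[a,b]}f\,d\mu$; for the real-valued $w$ it is the usual integral. The claim includes that the integral of $fw$ exists. *)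

(* Defs.v *)
From HB Require Import structures.
From mathcomp Require Import all_boot all_order all_algebra.
From mathcomp Require Import all_classical all_reals all_analysis.

Set Implicit Arguments.
Unset Strict Implicit.
Unset Printing Implicit Defensive.

Import Order.TTheory GRing.Theory Num.Theory.
Import numFieldNormedType.Exports.

Local Open Scope classical_set_scope.
Local Open Scope ring_scope.

(* [Order.Lattice] cannot be joined with [GRing.Lmodule] here: Hierarchy Builder
   requires that join to be declared before [Num.RealDomain]. Binary suprema are
   therefore a field; infima are then [- vjoin (- x) (- y)]. *)
HB.mixin Record isVectorLattice (R : numDomainType) X
    of Num.POrderedZmodule X & GRing.Lmodule R X := {
  vlat_leD2r : forall z x y : X, x <= y -> x + z <= y + z ;
  vlat_scaler_ge0 : forall (c : R) (x : X), 0 <= c -> 0 <= x -> 0 <= c *: x ;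
  vjoin : X -> X -> X ;
  vjoin_le : forall x y z : X, (vjoin x y <= z) = (x <= z) && (y <= z)
}.

#[short(type="vectorLatticeType")]
HB.structure Definition VectorLattice (R : numDomainType) :=
  {X of isVectorLattice R X & Num.POrderedZmodule X & GRing.Lmodule R X}.

Section VectorLatticeNotions.
Context (R : realType) (X : vectorLatticeType R).
Implicit Types (x y e : X) (f : R -> X).

Definition vabs x : X := vjoin x (- x).

Definition dedekind_complete : Prop :=
  forall A : set X, A !=set0 -> ubound A !=set0 -> supremums A !=set0.

(* [e] is nonzero, i.e. X is not the zero space. *)
Definition order_unit e : Prop :=
  0 < e /\ forall x, exists2 c : R, 0 < c & vabs x <= c *: e.

End VectorLatticeNotions.

Definition o_seq (Y : porderZmodType) (s : nat -> Y) : Prop :=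
  nonincreasing_seq s /\ infimums (range s) 0.

(* An (o)-sequence of strictly positive elements: in ]0, +oo[ for the reals,
   in X^+ for a vector lattice X. *)
Definition pos_o_seq (Y : porderZmodType) (s : nat -> Y) : Prop :=
  o_seq s /\ forall p, 0 < s p.

Section Differentiability.
Context (R : realType) (X : vectorLatticeType R).

(* Functions on [a, b] are represented by total functions on R, of which only
   the values on [a, b] are ever used. *)

(* The bound is [sigma p * e] for the multiplication of X, which is [sigma p]
   because the order unit [e] is the unit of that multiplication. *)
Definition uniformly_differentiable (a b : R) (f : R -> X) : Prop :=
  exists g : R -> X,
    (exists M : X, forall x, a <= x <= b -> vabs (g x) <= M) /\
    exists (sigma : nat -> X) (delta : nat -> R),
      [/\ o_seq sigma, pos_o_seq delta &
        forall p, exists2 s : X,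
          supremums [set vabs ((w.2 - w.1.1)^-1 *: (f w.2 - f w.1.1) - g w.1.2)
                    | w in [set w : R * R * R |
                        let: (u, x, v) := w in
                        [/\ a <= u, u <= x <= v, v <= b
                          & 0 < v - u <= delta p]]] s
          & s <= sigma p].

Definition vconvex (a b : R) (f : R -> X) : Prop :=
  forall t1 t t2 : R, a <= t1 -> t1 < t -> t < t2 -> t2 <= b ->
    f t <= f t1 + (t - t1) *: ((t2 - t1)^-1 *: (f t2 - f t1)).

End Differentiability.

Definition free_filter (F : set_system nat) : Prop :=
  ProperFilter F /\ forall A : set nat, finite_set (~` A) -> F A.

Section Integral.
Context (R : realType) (X : vectorLatticeType R) (e : X).
Context (F : set_system nat) (G : set R).
Implicit Types (f : R -> X) (fn : nat -> R -> X) (A B : set R).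

(* The Lebesgue measure, on the (complete) sigma-algebra of
   Caratheodory-measurable sets. *)
Local Notation mu := (@completed_lebesgue_measure R).

Definition lmeas A : Prop :=
  A `<=` G /\ ((wlength (@idfun R))^*)%mu.-cara.-measurable A.

Definition lmeas_fin A : Prop := lmeas A /\ (mu A < +oo)%E.

Definition o_lim (x : nat -> X) (l : X) : Prop :=
  exists2 sigma : nat -> X, o_seq sigma &
    forall p, F [set n | vabs (x n - l) <= sigma p].

Definition simple_fun f : Prop :=
  finite_set (f @` G) /\ forall x : X, lmeas (G `&` f @^-1` [set x]).

Definition Lstar f : Prop :=
  simple_fun f /\ exists2 B, lmeas_fin B & forall t, (G `\` B) t -> f t = 0.

(* For [f] in [Lstar], the sum of [mu (E_i) c_i] over the level sets of [f];
   the level set of the value 0 contributes 0, whatever its measure. *)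
Definition simple_int f : X :=
  \sum_(x \in f @` G) fine (mu (G `&` f @^-1` [set x])) *: x.

Definition simple_int_on A f : X := simple_int (patch (fun=> 0) A f).

Definition iota_norm f : X := simple_int (fun t => vabs (f t)).

Definition mu_converges fn f : Prop :=
  exists (eps sigma : nat -> R) (A : nat -> nat -> set R),
    [/\ pos_o_seq eps, pos_o_seq sigma,
        forall n p, lmeas (A n p) /\
          [set t | G t /\ ~ (vabs (fn n t - f t) <= eps p *: e)] `<=` A n p &
        forall p, F [set n | (mu (A n p) <= (sigma p)%:E)%E]].

Definition equi_ac fn : Prop :=
  (forall n, Lstar (fn n)) /\
  exists alpha : R,
    [/\ 0 < alpha,
        forall sigma : nat -> R, pos_o_seq sigma ->
          exists (w : nat -> X) (Lam : nat -> set nat),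
            [/\ pos_o_seq w, forall p, F (Lam p) &
              forall p n B, Lam p n -> lmeas B -> (mu B <= (sigma p)%:E)%E ->
                iota_norm (fun t => alpha *: patch (fun=> 0) B (fn n) t)
                  <= w p] &
        exists (r : nat -> X) (B : nat -> set R),
          [/\ pos_o_seq r, forall m, lmeas_fin (B m) &
            forall m, F [set n |
              iota_norm (fun t =>
                alpha *: patch (fun=> 0) (G `\` B m) (fn n) t) <= r m]]].

Definition is_pos_integral f (l : set R -> X) : Prop :=
  (forall t, G t -> 0 <= f t) /\
  exists fn : nat -> R -> X,
    [/\ equi_ac fn, mu_converges fn f &
      exists2 S : nat -> X,
        (forall n, supremums
           [set vabs (simple_int_on A (fn n) - l A) | A in lmeas] (S n)) &
        o_lim S 0].

Definition pos_integrable f : Prop := exists l, is_pos_integral f l.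

Definition fpos f : R -> X := fun t => vjoin (f t) 0.
Definition fneg f : R -> X := fun t => vjoin (- f t) 0.

Definition vintegrable f : Prop :=
  pos_integrable (fpos f) /\ pos_integrable (fneg f).

(* [I] is the integral of [f] over [A], for [A] a measurable subset of [G]. *)
Definition is_integral f A (I : X) : Prop :=
  exists l1 l2 : set R -> X,
    [/\ is_pos_integral (fpos f) l1, is_pos_integral (fneg f) l2
      & I = l1 A - l2 A].

End Integral.

(* Main.v *)
From mathcomp Require Import all_boot all_order all_algebra.
From mathcomp Require Import all_classical all_reals all_analysis.
From mathcomp Require Import finmap ring lra.
Require Import Defs.

Set Implicit Arguments.
Unset Strict Implicit.
Unset Printing Implicit Defensive.

Import Order.TTheory GRing.Theory Num.Theory.
Import numFieldNormedType.Exports.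

Local Open Scope classical_set_scope.
Local Open Scope ring_scope.

(** Everything happens in the norm of the order unit [e]: the relation
    [vabs x <= c *: e] with [c] real. Uniform differentiability gives a local
    Lipschitz bound [vabs (f v - f u) <= (K * `|v - u|) *: e]
    ([uniformly_differentiable_lipschitz]), because the difference quotients are
    within an element of [X] of a bounded function and every element of [X] is
    below a multiple of [e]. Together with the uniform continuity of [w] and the
    boundedness of [f] that follows from convexity, the function
    [t |-> w t *: f t] is uniformly continuous for [e]
    ([weighted_unif_continuous]), hence a uniform limit of functions that are
    constant, with the midpoint value, on each cell of a partition of [[a, b]]
    into equal cells.

    Uniform limits of simple functions are integrable
    ([uniform_limit_vintegrable]): simple functions uniformly close to each other
    have integrals close in the norm of [e] over all measurable sets at once, and
    Dedekind completeness provides the limit ([o_cauchy_cvg]). Conversely,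
    [is_pos_integral_dist] compares an arbitrary integral of a function, along an
    arbitrary defining sequence, with the integral of a simple function uniformly
    close to it. So every value [I] of the integral of [t |-> w t *: f t] is the
    limit of the midpoint sums of this function, just as the integral of [w] is
    the limit of the midpoint sums of [w] ([midpoint_sum_dist]).

    The inequality is then checked on midpoint sums. The midpoints [t] and
    [a + b - t] carry the same weight, so [f t] may be replaced with the average
    of [f t] and [f (a + b - t)] ([symmetric_midpoint_sum]), and by convexity this
    average lies between [f ((a + b) / 2)] ([vconvex_midpoint_le]) and the average
    of [f a] and [f b] ([vconvex_ends_ge]). The errors are arbitrarily small
    multiples of a fixed element of [X], and a Dedekind complete vector lattice is
    Archimedean ([vle_eps]). *)

(** * Vector lattices *)

Section VectorLatticeTheory.
Context {R : realType} {X : vectorLatticeType R}.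
Implicit Types (x y z e : X) (c d : R).

Lemma vleD2r z x y : (x + z <= y + z) = (x <= y).
Proof.
apply/idP/idP => [h|]; last exact: vlat_leD2r.
by have := vlat_leD2r (- z) _ _ h; rewrite !addrK.
Qed.

Lemma vleD2l z x y : (z + x <= z + y) = (x <= y).
Proof. by rewrite ![z + _]addrC vleD2r. Qed.

Lemma vleD x y z t : x <= y -> z <= t -> x + z <= y + t.
Proof. by move=> xy zt; apply: (@le_trans _ _ (y + z)); rewrite ?vleD2l ?vleD2r. Qed.

Lemma vsubr_ge0 x y : (0 <= y - x) = (x <= y).
Proof. by rewrite -(vleD2r x 0) add0r subrK. Qed.

Lemma vleBlDr x y z : (x - y <= z) = (x <= z + y).
Proof. by rewrite -(vleD2r y (x - y)) subrK. Qed.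

Lemma vleBrDr x y z : (x <= y - z) = (x + z <= y).
Proof. by rewrite -(vleD2r z x (y - z)) subrK. Qed.

Lemma vleN2 x y : (- x <= - y) = (y <= x).
Proof. by rewrite -(vsubr_ge0 (- x)) opprK addrC vsubr_ge0. Qed.

Lemma vaddr_ge0 x y : 0 <= x -> 0 <= y -> 0 <= x + y.
Proof. by move=> x0 y0; rewrite -(addr0 0) vleD. Qed.

Lemma vler_wpZ2l c x y : 0 <= c -> x <= y -> c *: x <= c *: y.
Proof.
move=> c0; rewrite -vsubr_ge0 => /(vlat_scaler_ge0 _ _ c0).
by rewrite scalerBr vsubr_ge0.
Qed.

Lemma vler_wpZ2r x c d : 0 <= x -> c <= d -> c *: x <= d *: x.
Proof.
by move=> x0; rewrite -subr_ge0 => cd; rewrite -vsubr_ge0 -scalerBl vlat_scaler_ge0.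
Qed.

Lemma vle_pZ2l c x y : 0 < c -> (c *: x <= c *: y) = (x <= y).
Proof.
move=> c0; apply/idP/idP => [h|]; last exact/vler_wpZ2l/ltW.
by move: (h) => /(vler_wpZ2l (ltW (_ : 0 < c^-1)));
  rewrite !scalerA mulVf ?gt_eqF// !scale1r; apply; rewrite invr_gt0.
Qed.

Lemma vscaler_gt0 c x : 0 < c -> 0 < x -> 0 < c *: x.
Proof.
move=> c0 x0; rewrite lt_neqAle vlat_scaler_ge0 ?ltW// andbT.
apply: contraTneq x0 => cx0; rewrite -[x]scale1r -(mulVf (lt0r_neq0 c0)).
by rewrite -scalerA -cx0 scaler0 ltxx.
Qed.

Lemma vler_sum (I : Type) (r : seq I) (P : pred I) (F G : I -> X) :
  (forall i, P i -> F i <= G i) ->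
  \sum_(i <- r | P i) F i <= \sum_(i <- r | P i) G i.
Proof. by move=> FG; elim/big_ind2 : _ => // *; exact: vleD. Qed.

Lemma vsumr_ge0 (I : Type) (r : seq I) (P : pred I) (F : I -> X) :
  (forall i, P i -> 0 <= F i) -> 0 <= \sum_(i <- r | P i) F i.
Proof. by move=> F0; elim/big_ind : _ => // *; exact: vaddr_ge0. Qed.

Lemma vle_joinl x y : x <= vjoin x y.
Proof. by have := lexx (vjoin x y); rewrite vjoin_le => /andP[]. Qed.

Lemma vle_joinr x y : y <= vjoin x y.
Proof. by have := lexx (vjoin x y); rewrite vjoin_le => /andP[]. Qed.

Lemma vjoinDr x y z : vjoin x y + z = vjoin (x + z) (y + z).
Proof.
apply/le_anti/andP; split; last first.
  by rewrite vjoin_le !vleD2r vle_joinl vle_joinr.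
by rewrite -vleBrDr vjoin_le !vleBrDr vle_joinl vle_joinr.
Qed.

Lemma vjoin_posB x : vjoin x 0 - vjoin (- x) 0 = x.
Proof.
apply/eqP; rewrite subr_eq addrC vjoinDr add0r addNr; apply/eqP.
by apply/le_anti; rewrite !vjoin_le !vle_joinl !vle_joinr.
Qed.

Lemma vabs_le x y : (vabs x <= y) = (- y <= x) && (x <= y).
Proof. by rewrite /vabs vjoin_le andbC -[in - x <= y](opprK y) vleN2. Qed.

Lemma vle_abs x : x <= vabs x. Proof. exact: vle_joinl. Qed.

Lemma vleN_abs x : - x <= vabs x. Proof. exact: vle_joinr. Qed.

Lemma vabsN x : vabs (- x) = vabs x.
Proof.
by apply/le_anti; rewrite /vabs !vjoin_le opprK !vle_joinl !vle_joinr.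
Qed.

Lemma vabs_distC x y : vabs (x - y) = vabs (y - x).
Proof. by rewrite -vabsN opprB. Qed.

Lemma vabs_ge0 x : 0 <= vabs x.
Proof.
rewrite -(@vle_pZ2l 2)// scaler0 scaler_nat mulr2n -(subrr x).
exact: vleD (vle_abs x) (vleN_abs x).
Qed.

Lemma vabs0 : vabs (0 : X) = 0.
Proof. by apply/le_anti; rewrite vabs_ge0 vabs_le oppr0 lexx. Qed.

Lemma ge0_vabs x : 0 <= x -> vabs x = x.
Proof.
move=> x0; apply/le_anti; rewrite vle_abs vabs_le lexx !andbT.
by apply: (le_trans _ x0); rewrite -oppr0 vleN2.
Qed.

Lemma vabsD x y : vabs (x + y) <= vabs x + vabs y.
Proof. by rewrite {1}/vabs vjoin_le opprD !vleD ?vle_abs ?vleN_abs. Qed.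

Lemma vabs_distD z x y : vabs (x - y) <= vabs (x - z) + vabs (z - y).
Proof. by rewrite -[x - y](subrKA z) vabsD. Qed.

Lemma vabsZ c x : vabs (c *: x) = `|c| *: vabs x.
Proof.
wlog c0 : c / 0 <= c => [hw|].
  have [/hw//|c0] := leP 0 c.
  by rewrite -vabsN -scaleNr hw ?normrN// oppr_ge0 ltW.
rewrite ger0_norm//; move: c0; rewrite le_eqVlt => /predU1P[<-|c0].
  by rewrite !scale0r vabs0.
apply/le_anti/andP; split.
  by rewrite /vabs vjoin_le -scalerN !vler_wpZ2l ?vle_joinl ?vle_joinr// ltW.
rewrite -(@vle_pZ2l c^-1) ?invr_gt0// scalerA mulVf ?gt_eqF// scale1r.
rewrite {1}/vabs vjoin_le.
rewrite -(@vle_pZ2l c _ (c^-1 *: _))// -(@vle_pZ2l c (- x))//.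
by rewrite !scalerA mulfV ?gt_eqF// scale1r scalerN vle_abs vleN_abs.
Qed.

Lemma vscale_le_dist c d (r : R) x :
  `|c - d| <= r -> c *: x <= d *: x + r *: vabs x.
Proof.
move=> cdr; rewrite addrC -vleBlDr -scalerBl (le_trans (vle_abs _))// vabsZ.
by rewrite vler_wpZ2r ?vabs_ge0.
Qed.

(** Taking the positive part is a contraction, which transfers approximations
    from a function to its positive and negative parts. *)
Lemma vabs_posB x y : vabs (vjoin x 0 - vjoin y 0) <= vabs (x - y).
Proof.
wlog suff : x y / vjoin x 0 - vjoin y 0 <= vabs (x - y).
  by move=> h; rewrite {1}/vabs vjoin_le opprB h vabs_distC h.
rewrite vleBlDr vjoin_le vaddr_ge0 ?vabs_ge0 ?vle_joinr// andbT.
by rewrite -[leLHS](subrK y) vleD ?vle_abs ?vle_joinl.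
Qed.

Lemma vabs_negB x y : vabs (vjoin (- x) 0 - vjoin (- y) 0) <= vabs (x - y).
Proof. by rewrite (le_trans (vabs_posB _ _))// -opprD vabsN. Qed.

Lemma o_seq_le0 (s : nat -> X) z : o_seq s -> (forall p, z <= s p) -> z <= 0.
Proof. by move=> [_ [_ h]] zs; apply: h => _ [p _ <-]. Qed.

Lemma o_seq_ge0 (s : nat -> X) p : o_seq s -> 0 <= s p.
Proof. by move=> [_ [h _]]; apply: h; exists p. Qed.

(** The terms of the two sequences may be taken at different ranks, by
    monotonicity; the infima are then taken one after the other. *)
Lemma o_seqD (s t : nat -> X) : o_seq s -> o_seq t -> o_seq (s \+ t).
Proof.
move=> hs ht; split.
  by move=> m n mn; apply: vleD; [apply: hs.1|apply: ht.1].
split=> [_ [p _ <-]|z zst]; first by rewrite vaddr_ge0// o_seq_ge0.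
apply: (o_seq_le0 ht) => q; rewrite -[leRHS]add0r -vleBlDr.
apply: (o_seq_le0 hs) => p; rewrite vleBlDr.
apply: (@le_trans _ _ (s (maxn p q) + t (maxn p q))).
  by apply: zst; exists (maxn p q).
by apply: vleD; [apply: hs.1; rewrite leq_maxl|apply: ht.1; rewrite leq_maxr].
Qed.

Lemma o_seqZ c (s : nat -> X) : 0 < c -> o_seq s -> o_seq (fun p => c *: s p).
Proof.
move=> c0 hs; split.
  by move=> m n mn; apply: vler_wpZ2l; [exact: ltW|apply: hs.1].
split=> [_ [p _ <-]|z zs]; first by rewrite vlat_scaler_ge0 ?(ltW c0)// o_seq_ge0.
rewrite -(@vle_pZ2l c^-1) ?invr_gt0// scaler0; apply: (o_seq_le0 hs) => p.
by rewrite -(@vle_pZ2l c)// scalerA mulfV ?gt_eqF// scale1r; apply: zs; exists p.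
Qed.

Context (X_complete : dedekind_complete X).

(** The supremum [s] of the multiples of [x] satisfies [s <= s - x], because
    [s - x] bounds the same multiples. *)
Lemma dedekind_archimedean x y : (forall n : nat, n%:R *: x <= y) -> x <= 0.
Proof.
move=> xy; have [||s [us ls]] := @X_complete (range (fun n : nat => n%:R *: x)).
- by exists (0%:R *: x); exists 0%N.
- by exists y => _ [n _ <-].
- have : s <= s - x.
    apply: ls => _ [n _ <-]; rewrite vleBrDr.
    by rewrite -[X in _ + X]scale1r -scalerDl natr1; apply: us; exists n.+1.
  by rewrite vleBrDr addrC -vleBrDr subrr.
Qed.

(** All multiples of [x - y] are bounded by [vabs z]. *)
Lemma vle_eps x y z : (forall c, 0 < c -> x <= y + c *: z) -> x <= y.
Proof.
move=> h; rewrite -vsubr_ge0 -(opprB x) -oppr0 vleN2.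
apply: (@dedekind_archimedean _ (vabs z)) => -[|n]; first by rewrite scale0r vabs_ge0.
have n0 : 0 < n.+1%:R :> R by rewrite ltr0n.
rewrite -(@vle_pZ2l n.+1%:R^-1) ?invr_gt0// scalerA mulVf ?gt_eqF// scale1r.
rewrite vleBlDr addrC; apply: (le_trans (h n.+1%:R^-1 _)); first by rewrite invr_gt0.
by rewrite vleD2l vler_wpZ2l ?vle_abs// invr_ge0 ltW.
Qed.

Lemma o_seq_scale (u : nat -> R) e : 0 <= e -> o_seq u ->
  o_seq (fun p => u p *: e).
Proof.
move=> e0 [un [u0 ul]]; have u0' p : 0 <= u p by apply: u0; exists p.
split; first by move=> m n mn; apply: vler_wpZ2r => //; exact: un.
split=> [_ [p _ <-]|z zu]; first exact: vlat_scaler_ge0.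
apply: (@vle_eps _ _ e) => c c0; rewrite add0r.
have [p upc] : exists p, u p <= c.
  apply: contrapT => /forallNP h; suff : c <= 0 by rewrite leNgt c0.
  by apply: ul => _ [p _ <-]; have /negP := h p; rewrite -ltNge => /ltW.
by apply: (@le_trans _ _ (u p *: e)); [apply: zu; exists p|exact: vler_wpZ2r].
Qed.

Lemma o_seq_harmonic : pos_o_seq (fun p => p.+1%:R^-1 : R).
Proof.
split; last by move=> p; rewrite invr_gt0.
split; first by move=> m n mn; rewrite lef_pV2 ?posrE// ler_nat ltnS.
split=> [_ [p _ <-]|z zu]; first by rewrite invr_ge0.
apply/ler_addgt0Pl => c c0; rewrite addr0.
have [n nc] : exists n : nat, n.+1%:R^-1 < c.
  have [n _ h] := near_infty_natSinv_lt (PosNum c0).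
  by exists n; apply: (h n) => /=.
by apply: (le_trans _ (ltW nc)); apply: zu; exists n.
Qed.

End VectorLatticeTheory.

(** * Integrals of simple functions *)

Section SimpleIntegral.
Context {R : realType} {X : vectorLatticeType R} (G : set R).
Implicit Types (f h : R -> X) (A B : set R) (T U : choiceType).

Local Notation mu := (@completed_lebesgue_measure R).

Lemma lmeas0 : lmeas G set0.
Proof. by split=> //; exact: measurable0. Qed.

Lemma lmeasI A B : lmeas G A -> lmeas G B -> lmeas G (A `&` B).
Proof. by move=> [AG mA] [_ mB]; split; [move=> t [/AG]|exact: measurableI]. Qed.

Lemma lmeasD A B : lmeas G A -> lmeas G B -> lmeas G (A `\` B).
Proof. by move=> [AG mA] [_ mB]; split; [move=> t [/AG]|exact: measurableD]. Qed.

Lemma lmeas_bigcup T (D : set T) (E : T -> set R) : finite_set D ->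
  (forall z, D z -> lmeas G (E z)) -> lmeas G (\bigcup_(z in D) E z).
Proof.
move=> fD mE; split; first by move=> t [z Dz]; apply: (mE z Dz).1.
by apply: fin_bigcup_measurable => // z Dz; exact: (mE z Dz).2.
Qed.

Context (G_meas : lmeas G G) (G_fin : (mu G < +oo)%E).

Lemma lmeas_le A B : lmeas G A -> lmeas G B -> A `<=` B -> (mu A <= mu B)%E.
Proof.
move=> [_ mA] [_ mB] AB.
by apply: (@le_measure _ _ _ mu) => //; exact: mem_set.
Qed.

Lemma lmeas_fin_num A : lmeas G A -> (mu A \is a fin_num)%E.
Proof.
move=> mA; rewrite ge0_fin_numE ?measure_ge0//.
by apply: le_lt_trans G_fin; apply: lmeas_le => //; exact: mA.1.
Qed.

(** The definition of simple functions for maps into an arbitrary type: a pair of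
    simple functions, or the indicator of a measurable set, is such a map, and
    composition with any function stays within the class. *)
Definition finite_level_map T (k : R -> T) :=
  finite_set (k @` G) /\ forall z, lmeas G (G `&` k @^-1` [set z]).

Lemma finite_level_map_comp T U (k : R -> T) (phi : T -> U) :
  finite_level_map k -> finite_level_map (phi \o k).
Proof.
move=> [fk mk]; split; first by rewrite -image_comp; exact: finite_image.
move=> u; rewrite (_ : _ `&` _ =
    \bigcup_(z in k @` G `&` phi @^-1` [set u]) (G `&` k @^-1` [set z])).
  by apply: lmeas_bigcup => // ; exact: finite_setIl.
apply/seteqP; split=> [t [Gt <-]|t [z [_ <-] [Gt]] <- //].
by exists (k t) => //; split=> //; exists t.
Qed.

Lemma finite_level_map_pair T U (k : R -> T) (l : R -> U) :
  finite_level_map k -> finite_level_map l ->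
  finite_level_map (fun t => (k t, l t)).
Proof.
move=> [fk mk] [fl ml]; split.
  apply: (@sub_finite_set _ _ (k @` G `*` l @` G)); last exact: finite_setX.
  by move=> _ [t Gt <-]; split; exists t.
move=> [z u]; rewrite (_ : _ `&` _ =
    (G `&` k @^-1` [set z]) `&` (G `&` l @^-1` [set u])); first exact: lmeasI.
by apply/seteqP; split=> [t [Gt [<- <-]]|t [[Gt <-] [_ <-]]].
Qed.

Lemma finite_level_map_mem A : lmeas G A -> finite_level_map (fun t => t \in A).
Proof.
move=> mA; split; first exact: finite_finset.
case.
  rewrite (_ : _ `&` _ = A) //; apply/seteqP; split=> t.
    by move=> [_]; rewrite /preimage/= => /set_mem.
  by move=> At; split; [exact: mA.1|exact: mem_set].
rewrite (_ : _ `&` _ = G `\` A); first exact: lmeasD.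
apply/seteqP; split=> t [Gt]; rewrite /preimage/=.
  by move=> /negbT; rewrite notin_setE.
by move=> nAt; split=> //; apply: memNset.
Qed.

Lemma simple_int_ext f h : (forall t, G t -> f t = h t) ->
  simple_int G f = simple_int G h.
Proof.
move=> fh; rewrite /simple_int.
have -> : f @` G = h @` G.
  by apply/seteqP; split=> _ [t Gt <-]; exists t => //; rewrite fh.
apply: eq_fsbigr => x _; congr (fine (mu _) *: _).
by apply/seteqP; split=> t [Gt] <-; split=> //=; rewrite fh.
Qed.

(** The integral may be computed on the level sets of any finite-valued
    measurable map through which the function factors. Applied to the map
    pairing several simple functions, this reduces their joint properties to
    finite sums over a common partition. *)
Lemma simple_int_comp T (k : R -> T) (phi : T -> X) f : finite_level_map k ->
  (forall t, G t -> f t = phi (k t)) ->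
  simple_int G f =
  \sum_(z <- fset_set (k @` G)) fine (mu (G `&` k @^-1` [set z])) *: phi z.
Proof.
move=> [fk mk] fE; rewrite (simple_int_ext fE) {f fE} /simple_int.
pose K := fset_set (k @` G).
have imE : (fun t => phi (k t)) @` G = phi @` (k @` G) by rewrite image_comp.
have fim : finite_set (phi @` (k @` G)) by exact: finite_image.
rewrite imE fsbig_finite//.
have levelE x : fine (mu (G `&` (fun t => phi (k t)) @^-1` [set x])) =
    \sum_(z <- K | phi z == x) fine (mu (G `&` k @^-1` [set z])).
  rewrite sum_fine; last by move=> z _; exact: lmeas_fin_num.
  congr fine; pose E z := if phi z == x then G `&` k @^-1` [set z] else set0.
  rewrite (_ : _ `&` _ = \bigcup_(z in k @` G) E z); last first.
    apply/seteqP; split=> [t [Gt /= fx]|t [z _]]; rewrite /E.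
      by exists (k t); [exists t|rewrite fx eqxx].
    by case: eqP => // <- [Gt <-].
  rewrite measure_fin_bigcup//; last 2 first.
  - move=> z u _ _ [t]; rewrite /E.
    by case: eqP => _ [] // [_ <-]; case: eqP => _ // [_ <-].
  - by move=> z _; rewrite /E; case: ifP => _; [exact: (mk z).2|exact: measurable0].
  rewrite fsbig_finite// [RHS]big_mkcond/=; apply: eq_bigr => z _; rewrite /E.
  by case: ifP => // _; rewrite measure0.
transitivity (\sum_(x <- fset_set (phi @` (k @` G))) \sum_(z <- K | phi z == x)
    fine (mu (G `&` k @^-1` [set z])) *: phi z).
  apply: eq_bigr => x _; rewrite levelE scaler_suml.
  by apply: eq_bigr => z /eqP ->.
rewrite (exchange_big_dep xpredT)//=; apply: eq_big_seq => z.
rewrite in_fset_set// => /set_mem kz; rewrite -big_filter.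
rewrite (eq_filter (_ : _ =1 pred1 (phi z))); last by move=> x; rewrite /= eq_sym.
rewrite filter_pred1_uniq ?fset_uniq ?big_seq1//.
by rewrite in_fset_set//; apply: mem_set; exists z.
Qed.

(** Values that are not attained contribute 0, so any duplicate-free list that
    contains the attained ones will do. *)
Lemma simple_int_seq T (k : R -> T) (phi : T -> X) f (r : seq T) :
  finite_level_map k -> uniq r -> (forall t, G t -> k t \in r) ->
  (forall t, G t -> f t = phi (k t)) ->
  simple_int G f = \sum_(z <- r) fine (mu (G `&` k @^-1` [set z])) *: phi z.
Proof.
move=> lk ur kr fE; rewrite (simple_int_comp lk fE) -fsbig_finite; last exact: lk.1.
apply: fsbig_fwiden => //; first by move=> _ [t Gt <-] /=; exact: kr.
move=> z [_ kz] /=; rewrite (_ : _ `&` _ = set0) ?measure0 ?scale0r//.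
by rewrite -subset0 => t [Gt ktz]; apply: kz; exists t.
Qed.

Lemma simple_intD f h : simple_fun G f -> simple_fun G h ->
  simple_int G (fun t => f t + h t) = simple_int G f + simple_int G h.
Proof.
move=> sf sh; have sfh := finite_level_map_pair sf sh.
rewrite (simple_int_comp (phi := fun z => z.1 + z.2) sfh)//.
rewrite (simple_int_comp (phi := fun z => z.1) (f := f) sfh)//.
rewrite (simple_int_comp (phi := fun z => z.2) (f := h) sfh)//.
by rewrite -big_split/=; apply: eq_bigr => z _; rewrite scalerDr.
Qed.

Lemma simple_funD f h : simple_fun G f -> simple_fun G h ->
  simple_fun G (fun t => f t + h t).
Proof.
move=> sf sh.
exact: (finite_level_map_comp (fun z => z.1 + z.2) (finite_level_map_pair sf sh)).
Qed.

Lemma simple_int_le f h : simple_fun G f -> simple_fun G h ->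
  (forall t, G t -> f t <= h t) -> simple_int G f <= simple_int G h.
Proof.
move=> sf sh fh; have sfh := finite_level_map_pair sf sh.
rewrite (simple_int_comp (phi := fun z => z.1) (f := f) sfh)//.
rewrite (simple_int_comp (phi := fun z => z.2) (f := h) sfh)//.
rewrite big_seq [leRHS]big_seq; apply: vler_sum => z.
rewrite in_fset_set; last exact: sfh.1.
move=> /set_mem[t Gt <-].
by apply: vler_wpZ2l; [rewrite fine_ge0|exact: fh].
Qed.

Lemma simple_intZ (c : R) f : simple_fun G f ->
  simple_int G (fun t => c *: f t) = c *: simple_int G f.
Proof.
move=> sf; rewrite (simple_int_comp (phi := fun z => c *: z) sf)//.
rewrite (simple_int_comp (phi := id) (f := f) sf)//.
by rewrite scaler_sumr; apply: eq_bigr => z _; rewrite !scalerA mulrC.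
Qed.

Lemma simple_funZ (c : R) f : simple_fun G f -> simple_fun G (fun t => c *: f t).
Proof. exact: (finite_level_map_comp (fun z => c *: z)). Qed.

Lemma simple_fun_abs f : simple_fun G f -> simple_fun G (fun t => vabs (f t)).
Proof. exact: (finite_level_map_comp (@vabs R X)). Qed.

Lemma simple_fun_pos f : simple_fun G f -> simple_fun G (fpos f).
Proof. exact: (finite_level_map_comp (fun x : X => vjoin x 0)). Qed.

Lemma simple_fun_neg f : simple_fun G f -> simple_fun G (fneg f).
Proof. exact: (finite_level_map_comp (fun x : X => vjoin (- x) 0)). Qed.

Lemma simple_fun_patch A f : lmeas G A -> simple_fun G f ->
  simple_fun G (patch (fun=> 0) A f).
Proof.
move=> mA sf.
exact: (finite_level_map_comp (fun z => if z.1 then z.2 else 0)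
  (finite_level_map_pair (finite_level_map_mem mA) sf)).
Qed.

Lemma simple_fun_cst (x : X) : simple_fun G (fun=> x).
Proof.
apply: (@finite_level_map_comp _ _ (fun t => t \in G) (fun=> x)).
exact: finite_level_map_mem.
Qed.

Lemma simple_intB f h : simple_fun G f -> simple_fun G h ->
  simple_int G (fun t => f t - h t) = simple_int G f - simple_int G h.
Proof.
move=> sf sh; rewrite -[- simple_int G h]scaleN1r -simple_intZ//.
rewrite -simple_intD//; last exact: simple_funZ.
by apply: simple_int_ext => t _; rewrite scaleN1r.
Qed.

Lemma simple_funB f h : simple_fun G f -> simple_fun G h ->
  simple_fun G (fun t => f t - h t).
Proof.
move=> sf sh.
exact: (finite_level_map_comp (fun z => z.1 - z.2) (finite_level_map_pair sf sh)).
Qed.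

Lemma simple_int_abs f : simple_fun G f -> vabs (simple_int G f) <= iota_norm G f.
Proof.
move=> sf; have saf := simple_fun_abs sf; rewrite vabs_le; apply/andP; split.
  rewrite -scaleN1r -simple_intZ//; apply: simple_int_le => //.
    exact: simple_funZ.
  by move=> t _; rewrite scaleN1r -(vleN2 (f t)) opprK vleN_abs.
by apply: simple_int_le => // t _; exact: vle_abs.
Qed.

Lemma simple_int_cst_patch A (x : X) : lmeas G A ->
  simple_int G (patch (fun=> 0) A (fun=> x)) = fine (mu A) *: x.
Proof.
move=> mA; have sA := finite_level_map_mem mA.
rewrite (simple_int_seq (phi := fun b : bool => if b then x else 0)
  (r := [:: true; false]) sA)//; last by move=> t _; case: (t \in A).
rewrite big_cons big_seq1 scaler0 addr0; congr (fine (mu _) *: _).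
by apply/seteqP; split=> [t [_ /set_mem]|t At] //; split;
  [exact: mA.1|exact: mem_set].
Qed.

Lemma simple_int_cst (x : X) : simple_int G (fun=> x) = fine (mu G) *: x.
Proof.
rewrite -simple_int_cst_patch//; apply: simple_int_ext => t Gt.
by rewrite patchT//; exact: mem_set.
Qed.

Lemma simple_int_abs_le f (x : X) : simple_fun G f ->
  (forall t, G t -> vabs (f t) <= x) -> vabs (simple_int G f) <= fine (mu G) *: x.
Proof.
move=> sf fx; apply: (le_trans (simple_int_abs sf)); rewrite -simple_int_cst.
by apply: simple_int_le => //; [exact: simple_fun_abs|exact: simple_fun_cst].
Qed.

End SimpleIntegral.

(** * Integrals of uniform limits of simple functions *)

Section UniformLimits.
Context {R : realType} {X : vectorLatticeType R} (e : X) (F : set_system nat).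
Context (G : set R).
Context (X_complete : dedekind_complete X) (e_unit : order_unit e).
Context (F_free : free_filter F).
Context (G_meas : lmeas G G).

Local Notation mu := (@completed_lebesgue_measure R).

Context (G_fin : (mu G < +oo)%E).
Implicit Types (f g h : R -> X) (A B : set R).

Let e_ge0 : 0 <= e. Proof. exact/ltW/e_unit.1. Qed.

Lemma simple_fun_bounded h : simple_fun G h ->
  exists2 C : R, 0 < C & forall t, G t -> vabs (h t) <= C *: e.
Proof.
move=> [fh _]; pose s := \sum_(x <- fset_set (h @` G)) vabs x.
have [C C0 sC] := e_unit.2 s; exists C => // t Gt.
apply: le_trans sC; apply: le_trans (vle_abs _).
rewrite /s (big_rem (h t))/=; last first.
  by rewrite in_fset_set//; apply: mem_set; exists t.
by rewrite -[leLHS]addr0 vleD2l vsumr_ge0// => x _; exact: vabs_ge0.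
Qed.

(** Outside a set [A] of small measure the approximating simple functions of [g]
    are uniformly close to [h]; on [A] the equi-absolute continuity of the
    former and the boundedness of [h] make both integrals small. Hence the
    integral of [g] does not depend on the approximating sequence. *)
Lemma is_pos_integral_dist g (l : set R -> X) h (d : R) :
  is_pos_integral e F G g l -> simple_fun G h ->
  (forall t, G t -> vabs (g t - h t) <= d *: e) ->
  vabs (l G - simple_int G h) <= (d * fine (mu G)) *: e.
Proof.
move=> [_ [fn [[fnL [al [al0 fnac _]]] [eps [sig [A [eps0 sig0 AP Asig]]]]
  [S SP [sS sS0 SsS]]]]] sh gh.
have [w [Lam [w0 FLam wP]]] := fnac _ sig0.
have [C C0 hC] := simple_fun_bounded sh.
(* The errors of rank [p], in this order: the convergence of the integrals, [fn n]
   on [A n p], [h] on [A n p], and the distance of [fn n] to [g] off [A n p]. *)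
pose rest p := sS p + (al^-1 *: w p + (sig p *: (C *: e) +
  eps p *: (fine (mu G) *: e))).
have rest0 : o_seq rest.
  apply: o_seqD => //; apply: o_seqD.
    by apply: o_seqZ; [rewrite invr_gt0|exact: w0.1].
  apply: o_seqD; apply: o_seq_scale => //; [|exact: sig0.1| |exact: eps0.1].
    by rewrite vlat_scaler_ge0// ltW.
  by rewrite vlat_scaler_ge0// fine_ge0.
rewrite -[leRHS]add0r -vleBlDr; apply: (o_seq_le0 rest0) => p; rewrite vleBlDr.
have PF : ProperFilter F := F_free.1.
have [n [[Ln An] Sn]] :=
  @filter_ex _ _ PF _ (filterI (filterI (FLam p) (Asig p)) (SsS p)).
have [mA hA] := AP n p; have [sfn _] := fnL n.
rewrite (le_trans (vabs_distD (simple_int G (fn n)) _ _))// /rest -!addrA vleD//.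
  rewrite vabs_distC (_ : simple_int G (fn n) = simple_int_on G G (fn n)).
    move: Sn; rewrite /= subr0; apply: le_trans; apply: le_trans (vle_abs _).
    by apply: (SP n).1; exists G.
  by apply: simple_int_ext => t Gt; rewrite patchT//; exact: mem_set.
rewrite -simple_intB//; have sfnh := simple_funB sfn sh.
apply: (le_trans (simple_int_abs G_meas G_fin sfnh)).
(* The integrand is dominated by the sum of three simple functions: [vabs (fn n)]
   on [A n p], the bound of [h] on [A n p], and a constant close to [d *: e]. *)
pose dom t := patch (fun=> 0) (A n p) (fun t => vabs (fn n t)) t +
  (patch (fun=> 0) (A n p) (fun=> C *: e) t + (eps p + d) *: e).
have s1 := simple_fun_patch G_meas mA (simple_fun_abs sfn).
have s2 : simple_fun G (patch (fun=> 0) (A n p) (fun=> C *: e)).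
  by apply: simple_fun_patch => //; exact: simple_fun_cst.
have s3 : simple_fun G (fun=> (eps p + d) *: e) by exact: simple_fun_cst.
have s23 := simple_funD s2 s3.
have dpe0 : 0 <= eps p *: e by rewrite vlat_scaler_ge0// ltW// eps0.2.
apply: (@le_trans _ _ (simple_int G dom)).
  apply: simple_int_le => //; [exact: simple_fun_abs|exact: simple_funD|].
  move=> t Gt; rewrite /dom /patch.
  have de0 : 0 <= d *: e by apply: le_trans (gh _ Gt); exact: vabs_ge0.
  case: ifPn => [_|]; last first.
    rewrite notin_setE !add0r => nAt; rewrite scalerDl.
    rewrite (le_trans (vabs_distD (g t) _ _))// vleD ?gh//.
    by apply: contrapT => ngt; apply: nAt; apply: hA.
  rewrite (le_trans (vabsD _ _))// vabsN vleD2l -[leLHS]addr0.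
  by rewrite vleD ?hC// scalerDl vaddr_ge0.
rewrite simple_intD// simple_intD// simple_int_cst// simple_int_cst_patch//.
apply: vleD.
  rewrite -(@vle_pZ2l _ _ al)// scalerA mulfV ?gt_eqF// scale1r.
  rewrite -simple_intZ//; apply: le_trans (wP _ _ _ Ln mA An).
  rewrite le_eqVlt; apply/orP; left; apply/eqP; apply: simple_int_ext => t _.
  rewrite vabsZ (gtr0_norm al0) /patch; case: ifP => // _; by rewrite vabs0.
apply: vleD.
  apply: vler_wpZ2r; first by rewrite vlat_scaler_ge0// ltW.
  by rewrite -lee_fin fineK//; exact: (lmeas_fin_num G_meas G_fin mA).
by rewrite !scalerA -scalerDl mulrDr mulrC [_ * d]mulrC.
Qed.

(** All [x n - c n *: u] lie below all [x m + c m *: u], and the limit is the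
    supremum of the former. *)
Lemma o_cauchy_cvg (x : nat -> X) (c : nat -> R) (u : X) :
  (forall n m, vabs (x n - x m) <= (c n + c m) *: u) ->
  exists l, forall n, vabs (x n - l) <= c n *: u.
Proof.
move=> xc; have xle n m : x n - c n *: u <= x m + c m *: u.
  rewrite vleBlDr -addrA -scalerDl [c m + _]addrC addrC -vleBlDr.
  exact: le_trans (vle_abs _) (xc n m).
have [||l [ul ll]] := @X_complete (range (fun n => x n - c n *: u)).
- by exists (x 0%N - c 0%N *: u); exists 0%N.
- by exists (x 0%N + c 0%N *: u) => _ [n _ <-].
exists l => n; rewrite vabs_distC vabs_le; apply/andP; split.
  by rewrite vleBrDr addrC; apply: ul; exists n.
by rewrite vleBlDr addrC; apply: ll => _ [m _ <-].
Qed.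

Lemma free_filter_ge (P : set nat) p : (forall n, (p <= n)%N -> P n) -> F P.
Proof.
move=> pP; apply: F_free.2; apply: (@sub_finite_set _ _ `I_p); last exact: finite_II.
by move=> n nPn /=; rewrite ltnNge; apply/negP => /pP.
Qed.

(** The simple functions of a uniformly convergent sequence are uniformly
    bounded by a multiple of [e], which makes them equi-absolutely continuous;
    their integrals over all measurable sets are Cauchy with the same modulus. *)
Lemma uniform_limit_pos_integrable g : (forall t, G t -> 0 <= g t) ->
  (forall d : R, 0 < d ->
    exists2 h, simple_fun G h & forall t, G t -> vabs (g t - h t) <= d *: e) ->
  pos_integrable e F G g.
Proof.
move=> g0 gh; pose eps n : R := n.+1%:R^-1.
have epsP : pos_o_seq eps by exact: o_seq_harmonic.
have eps1 n : eps n <= 1 by rewrite invf_le1 ?ltr0n// ler1n.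
have epsn p n : (p <= n)%N -> eps n <= eps p by exact: epsP.1.1.
have /choice[h hP] n : exists h, simple_fun G h /\
    forall t, G t -> vabs (g t - h t) <= eps n *: e.
  by have [h sh hg] := gh _ (epsP.2 n); exists h.
have sh n : simple_fun G (h n) by exact: (hP n).1.
have {hP}hg n t : G t -> vabs (g t - h n t) <= eps n *: e by exact: (hP n).2.
have [C0 C00 hC0] := simple_fun_bounded (sh 0%N).
(* [h n] is within [e] of [g], which is within [e] of [h 0]. *)
pose C : R := 1 + (1 + C0); have C_gt0 : 0 < C by rewrite /C; lra.
have hC n t : G t -> vabs (h n t) <= C *: e.
  move=> Gt; rewrite -[h n t]subr0 /C scalerDl.
  rewrite (le_trans (vabs_distD (g t) _ _))// vleD//.
    by rewrite vabs_distC (le_trans (hg n t Gt))// vler_wpZ2r.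
  rewrite subr0 -[g t]subr0 scalerDl (le_trans (vabs_distD (h 0%N t) _ _))// vleD//.
    by rewrite (le_trans (hg _ t Gt))// vler_wpZ2r.
  by rewrite subr0 hC0.
have Lh n : Lstar G (h n).
  by split => //; exists G; [split|move=> t []].
pose u := fine (mu G) *: e.
have u0 : 0 <= u by rewrite vlat_scaler_ge0// fine_ge0.
have /choice[l lP] A : exists l, lmeas G A ->
    forall n, vabs (simple_int_on G A (h n) - l) <= eps n *: u.
  have [mA|] := pselect (lmeas G A); last by exists 0.
  have [n m|l lP] := @o_cauchy_cvg (fun n => simple_int_on G A (h n)) eps u;
    last by exists l.
  rewrite /u scalerA mulrC -scalerA /simple_int_on.
  rewrite -simple_intB//; try exact: simple_fun_patch.
  apply: simple_int_abs_le => //; first by apply: simple_funB; exact: simple_fun_patch.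
  move=> t Gt; rewrite /patch; case: ifP => _; last first.
    by rewrite subrr vabs0 vlat_scaler_ge0// addr_ge0// ltW// epsP.2.
  rewrite scalerDl (le_trans (vabs_distD (g t) _ _))// vleD ?hg//.
  by rewrite vabs_distC hg.
exists l; split=> //; exists h; split.
- split=> //; exists 1; split => //.
    move=> sig sig0; exists (fun p => sig p *: (C *: e)), (fun=> setT); split.
    + split.
        by apply: o_seq_scale; [|rewrite vlat_scaler_ge0// ltW|exact: sig0.1].
      by move=> p; rewrite !vscaler_gt0 ?sig0.2//; exact: e_unit.1.
    + by move=> p; have PF := F_free.1; exact: filterT.
    + move=> p n B _ mB Bsig.
      apply: (@le_trans _ _ (fine (mu B) *: (C *: e))); last first.
        apply: vler_wpZ2r; first by rewrite vlat_scaler_ge0// ltW.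
        by rewrite -lee_fin fineK//; exact: (lmeas_fin_num G_meas G_fin mB).
      rewrite -(simple_int_cst_patch G_meas G_fin)//; apply: simple_int_le => //.
      * by apply: simple_fun_abs; apply: simple_funZ; exact: simple_fun_patch.
      * by apply: simple_fun_patch => //; exact: simple_fun_cst.
      * by move=> t Gt; rewrite scale1r /patch; case: ifP; rewrite ?vabs0 ?hC.
  exists (fun m => eps m *: e), (fun=> G); split => //.
    split; first by apply: o_seq_scale => //; exact: epsP.1.
    by move=> p; rewrite vscaler_gt0 ?epsP.2//; exact: e_unit.1.
  move=> m; apply: (@free_filter_ge _ 0%N) => n _ /=.
  rewrite /iota_norm (simple_int_ext (h := fun=> 0)).
    by rewrite simple_int_cst// scaler0 vlat_scaler_ge0// ltW// epsP.2.
  by move=> t Gt; rewrite setDv /patch in_set0 scaler0 vabs0.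
(* From rank [p] on, the approximation holds everywhere up to [eps p]. *)
- exists eps, eps, (fun n p => if (p <= n)%N then set0 else G); split => //.
    move=> n p; split; first by case: ifP => // _; exact: lmeas0.
    move=> t [Gt nle]; case: ifPn => // pn; exfalso; apply: nle.
    rewrite vabs_distC (le_trans (hg n t Gt))// vler_wpZ2r//; exact: epsn.
  move=> p; apply: (@free_filter_ge _ p) => n pn /=; rewrite pn measure0.
  by rewrite lee_fin ltW// epsP.2.
- pose V n := [set vabs (simple_int_on G A (h n) - l A) | A in lmeas G].
  have Vub n : ubound (V n) (eps n *: u) by move=> _ [A mA <-]; exact: lP.
  have V0 n : V n (vabs (simple_int_on G set0 (h n) - l set0)).
    by exists set0 => //; exact: lmeas0.
  have /choice[S SP] n : exists s, supremums (V n) s.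
    by have [||s] := @X_complete (V n);
      [eexists; exact: V0|exists (eps n *: u)|exists s].
  exists S => //; exists (fun p => eps p *: u).
    by apply: o_seq_scale => //; exact: epsP.1.
  move=> p; apply: (@free_filter_ge _ p) => n pn /=; rewrite subr0 ge0_vabs.
    apply: (@le_trans _ _ (eps n *: u)); first by apply: (SP n).2.
    by apply: vler_wpZ2r => //; exact: epsn.
  by apply: le_trans ((SP n).1 _ (V0 n)); exact: vabs_ge0.
Qed.

(** Both parts of [f] are uniform limits of the corresponding parts of the simple
    functions, since taking either part is a contraction. *)
Lemma uniform_limit_vintegrable f :
  (forall d : R, 0 < d ->
    exists2 h, simple_fun G h & forall t, G t -> vabs (f t - h t) <= d *: e) ->
  vintegrable e F G f.
Proof.
move=> fh; split.
  apply: uniform_limit_pos_integrable => [t _|d d0]; first exact: vle_joinr.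
  have [h sh hf] := fh _ d0; exists (fpos h); first exact: simple_fun_pos.
  by move=> t /hf; apply: le_trans; exact: vabs_posB.
apply: uniform_limit_pos_integrable => [t _|d d0]; first exact: vle_joinr.
have [h sh hf] := fh _ d0; exists (fneg h); first exact: simple_fun_neg.
by move=> t /hf; apply: le_trans; exact: vabs_negB.
Qed.

Lemma is_integral_dist f h (d : R) (I : X) :
  is_integral e F G f G I -> simple_fun G h ->
  (forall t, G t -> vabs (f t - h t) <= d *: e) ->
  vabs (I - simple_int G h) <= (2 * (d * fine (mu G))) *: e.
Proof.
move=> [l1 [l2 [int1 int2 ->]]] sh fh.
have -> : simple_int G h = simple_int G (fpos h) - simple_int G (fneg h).
  rewrite -simple_intB//; [|exact: simple_fun_pos|exact: simple_fun_neg].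
  by apply: simple_int_ext => t _; rewrite /fpos /fneg vjoin_posB.
have d1 : vabs (l1 G - simple_int G (fpos h)) <= (d * fine (mu G)) *: e.
  apply: (is_pos_integral_dist int1); first exact: simple_fun_pos.
  by move=> t /fh; apply: le_trans; exact: vabs_posB.
have d2 : vabs (l2 G - simple_int G (fneg h)) <= (d * fine (mu G)) *: e.
  apply: (is_pos_integral_dist int2); first exact: simple_fun_neg.
  by move=> t /fh; apply: le_trans; exact: vabs_negB.
rewrite mulr_natl mulr2n scalerDl opprB [simple_int _ (fneg h) - _]addrC addrACA.
by rewrite (le_trans (vabsD _ _))// vleD// addrC vabs_distC.
Qed.

End UniformLimits.

(** * Uniformly continuous real functions on a segment *)

Section RealWeight.
Context {R : realType} (a b : R).

Lemma unif_continuous_itvP (w : R -> R) (eps : R) :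
  unif_continuous (w : subspace `[a, b] -> R) -> 0 < eps ->
  exists2 d : R, 0 < d & forall s t, a <= s <= b -> a <= t <= b ->
    `|s - t| < d -> `|w s - w t| < eps.
Proof.
move=> /unif_continuousP/(_ eps) + eps0 => /(_ eps0)[d d0 h].
exists d => // s t sab tab st; apply: (h (s, t)).
by rewrite /ball/= /subspace_ball mem_set.
Qed.

Lemma unif_continuous_itv_within (w : R -> R) :
  unif_continuous (w : subspace `[a, b] -> R) -> {within `[a, b], continuous w}.
Proof.
move=> /unif_continuousP uw x; apply/cvgrPdist_lt => eps eps0.
have [d d0 h] := uw _ eps0; apply/nbhs_ballP; exists d => // t xt.
exact: (h (x, t)).
Qed.

End RealWeight.

(** * Midpoint sums over equal cells *)

Section EqualCells.
Context {R : realType} (a b : R) (a_lt_b : a < b).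
Implicit Types (n i : nat) (t : R).

Local Notation mu := (@completed_lebesgue_measure R).

Definition mesh n : R := (b - a) / n.+1%:R.
Definition node n i : R := a + i%:R * mesh n.
Definition midpoint n i : R := a + (i%:R + 2^-1) * mesh n.

(** The cells are closed on the left and open on the right, except that the last
    one contains [b]; hence the truncation by [n]. *)
Definition cell n t : nat := minn n (Num.truncn ((t - a) / mesh n)).
Definition cell_itv n i : interval R :=
  Interval (BLeft (node n i)) (BSide (i < n)%N (node n i.+1)).

Lemma mesh_gt0 n : 0 < mesh n.
Proof. by rewrite divr_gt0 ?subr_gt0 ?ltr0n. Qed.

Lemma node_last n : node n n.+1 = b.
Proof. by rewrite /node mulrC divfK ?pnatr_eq0//; ring. Qed.

Lemma node_lt n i : node n i < node n i.+1.
Proof. by rewrite ltrD2l ltr_pM2r ?mesh_gt0// ltr_nat. Qed.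

Lemma cell_le n t : (cell n t <= n)%N. Proof. exact: geq_minl. Qed.

Lemma cell_itvE n t i : a <= t <= b -> (i <= n)%N ->
  (cell n t == i) = (t \in cell_itv n i).
Proof.
move=> /andP[at_ tb] iN; have d0 := mesh_gt0 n.
have y0 : 0 <= (t - a) / mesh n by rewrite divr_ge0 ?subr_ge0// ltW.
have nodeE j : (node n j <= t) = (j%:R <= (t - a) / mesh n).
  by rewrite ler_pdivlMr// lerBrDl.
rewrite in_itv/= /cell; move: iN; rewrite leq_eqVlt => /predU1P[->|iN].
  rewrite ltnn /= node_last tb andbT nodeE -truncn_ge_nat//.
  by rewrite -(sameP eqP minn_idPl).
rewrite iN/= nodeE ltNge nodeE -ltNge -truncn_eq//.
rewrite /minn; case: ltnP => // nq.
by rewrite gtn_eqF// gtn_eqF// (ltn_trans iN).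
Qed.

Lemma cell_itv_sub n i t : (i <= n)%N -> t \in cell_itv n i -> a <= t <= b.
Proof.
move=> iN; rewrite in_itv/= => /andP[lt_ ut].
have ut' : t <= node n i.+1 by case: (i < n)%N ut => // /ltW.
have d0 := mesh_gt0 n; apply/andP; split.
  by apply: le_trans lt_; rewrite lerDl mulr_ge0// ltW.
by rewrite -(node_last n) (le_trans ut')// lerD2l ler_pM2r// ler_nat.
Qed.

Lemma preimage_cell n i : (i <= n)%N ->
  `[a, b]%classic `&` cell n @^-1` [set i] = [set` cell_itv n i].
Proof.
move=> iN; apply/seteqP; split=> t /=.
  by rewrite in_itv/= => -[tab] /eqP; rewrite cell_itvE.
move=> ti; have tab := cell_itv_sub iN ti.
by rewrite in_itv/=; split=> //; apply/eqP; rewrite cell_itvE.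
Qed.

Lemma midpoint_itv n i : (i <= n)%N -> a < midpoint n i < b.
Proof.
have d0 := mesh_gt0 n.
move=> iN; apply/andP; split.
  by rewrite /midpoint ltrDl mulr_gt0// addr_ge0_gt0.
rewrite -[ltRHS](node_last n) /midpoint /node ltrD2l ltr_pM2r//.
apply: (@lt_le_trans _ _ i.+1%:R); last by rewrite ler_nat ltnS.
by rewrite -(natr1 i) ltrD2l; lra.
Qed.

(** The midpoints are symmetric about [(a + b) / 2], which is why midpoints are
    chosen as sample points. *)
Lemma midpoint_rev n i : (i <= n)%N -> midpoint n (n - i) = a + b - midpoint n i.
Proof.
move=> iN; have := node_last n; rewrite /node /midpoint natrB// -(natr1 n).
by move: (mesh n) => d <-; field.
Qed.

Lemma cell_dist n t i : t \in cell_itv n i -> `|t - midpoint n i| < mesh n.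
Proof.
have d0 := mesh_gt0 n; rewrite in_itv/= => /andP[lt_ ut].
have {}ut : t <= node n i.+1 by case: (i < n)%N ut => // /ltW.
move: lt_ ut; rewrite /node /midpoint -(natr1 i) => lt_ ut.
by rewrite ltr_norml; apply/andP; split; nra.
Qed.

Lemma mesh_small (d : R) : 0 < d -> exists n, mesh n < d.
Proof.
move=> d0; exists (Num.truncn ((b - a) / d)).
by rewrite ltr_pdivrMr ?ltr0n// mulrC -ltr_pdivrMr// truncnS_gt.
Qed.

Lemma lebesgue_measure_cell n i :
  lebesgue_measure [set` cell_itv n i] = (mesh n)%:E.
Proof.
rewrite lebesgue_measure_itv/= lte_fin node_lt -EFinB.
by congr (_%:E); rewrite /node -(natr1 i); ring.
Qed.

Lemma itv_lmeas (i : interval R) : [set` i] `<=` `[a, b] ->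
  lmeas `[a, b] [set` i].
Proof.
move=> iab; split=> //; apply: sub_caratheodory.
exact: (@measurable_itv R i).
Qed.

Lemma finite_level_cell n : finite_level_map `[a, b] (cell n).
Proof.
split.
  apply: (@sub_finite_set _ _ `I_n.+1); last exact: finite_II.
  by move=> _ [t _ <-] /=; rewrite ltnS cell_le.
move=> i; have [iN|iN] := leqP i n.
  rewrite preimage_cell//; apply: itv_lmeas => t /= ti.
  by rewrite in_itv/=; exact: cell_itv_sub ti.
rewrite (_ : _ `&` _ = set0); first exact: lmeas0.
by rewrite -subset0 => t [_ /= it]; have := cell_le n t; rewrite it leqNgt iN.
Qed.

Lemma lebesgue_measure_segment : mu `[a, b] = (b - a)%:E.
Proof.
by rewrite [LHS](@lebesgue_measure_itv R `[a, b])/= lte_fin a_lt_b EFinB.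
Qed.

Lemma segment_lmeas : lmeas `[a, b] `[a, b].
Proof. exact: itv_lmeas. Qed.

Lemma segment_fin : (mu `[a, b] < +oo)%E.
Proof. by rewrite lebesgue_measure_segment ltry. Qed.

Section VectorValued.
Context {X : vectorLatticeType R}.
Implicit Types (phi : R -> X).

Definition midpoint_step n phi t := phi (midpoint n (cell n t)).

Lemma midpoint_step_simple n phi : simple_fun `[a, b] (midpoint_step n phi).
Proof.
exact: (finite_level_map_comp (fun i => phi (midpoint n i)) (finite_level_cell n)).
Qed.

Lemma midpoint_step_dist n t : a <= t <= b ->
  `|t - midpoint n (cell n t)| < mesh n.
Proof.
by move=> tab; apply: cell_dist; rewrite -cell_itvE// cell_le.
Qed.

Lemma midpoint_step_int n phi : simple_int `[a, b] (midpoint_step n phi) =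
  \sum_(i < n.+1) mesh n *: phi (midpoint n i).
Proof.
rewrite (simple_int_seq segment_lmeas segment_fin (r := iota 0 n.+1)
  (phi := fun i => phi (midpoint n i)) (finite_level_cell n)) ?iota_uniq//.
  rewrite -[iota _ _]/(index_iota 0 n.+1) big_mkord; apply: eq_bigr => i _.
  by rewrite preimage_cell ?leq_ord// [mu _](lebesgue_measure_cell n i).
by move=> t _; rewrite mem_iota/= add0n ltnS cell_le.
Qed.

End VectorValued.

(** Both sides are sums over the cells, and the two summands for one cell differ
    by at most the oscillation of [w] times the mesh. *)
Lemma midpoint_sum_dist (w : R -> R) n (c : R) :
  (forall t, a <= t <= b -> 0 <= w t) -> {within `[a, b], continuous w} ->
  (forall t, a <= t <= b -> `|w t - w (midpoint n (cell n t))| <= c) ->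
  `|\int[lebesgue_measure]_(t in `[a, b]) w t -
    \sum_(i < n.+1) mesh n * w (midpoint n i)| <= c * (b - a).
Proof.
move=> w0 cw wc.
have iw : (@lebesgue_measure R).-integrable `[a, b] (EFin \o w).
  by apply: continuous_compact_integrable => //; exact: segment_compact.
(* Truncating the index keeps every [E i] inside the segment. *)
pose E i := [set` cell_itv n (minn i n)].
have ErdE (i : 'I_n.+1) : E i = [set` cell_itv n i].
  by rewrite /E (minn_idPl _)// leq_ord.
have Esub i : E i `<=` `[a, b].
  by move=> t /(cell_itv_sub (geq_minr _ _)); rewrite /= in_itv.
have iwE i : (@lebesgue_measure R).-integrable (E i) (EFin \o w).
  apply: (@integrableS _ _ R lebesgue_measure `[a, b] (E i)) => //.
  exact: measurable_itv.
have abE : `[a, b]%classic = \big[setU/set0]_(i <- iota 0 n.+1) E i.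
  rewrite -bigcup_seq; apply/seteqP; split=> t; last by move=> [i _ /Esub].
  rewrite /= in_itv/= => tab; exists (cell n t).
    by change (cell n t \in iota 0 n.+1); rewrite mem_iota add0n ltnS cell_le.
  by rewrite /E (minn_idPl _) ?cell_le//= -cell_itvE// cell_le.
have -> : \int[lebesgue_measure]_(t in `[a, b]) w t =
    \sum_(i < n.+1) \int[lebesgue_measure]_(t in E i) w t.
  rewrite /Rintegral [in LHS]abE ge0_integral_bigsetU ?iota_uniq//.
  - rewrite -[iota _ _]/(index_iota 0 n.+1) big_mkord sum_fine// => i _.
    apply: (integrable_fin_num _ (iwE i)); exact: measurable_itv.
  - by move=> i; exact: measurable_itv.
  - move=> i j; change (i \in iota 0 n.+1 -> j \in iota 0 n.+1 ->
      E i `&` E j !=set0 -> i = j).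
    rewrite !mem_iota !add0n !ltnS => iN jN [t []].
    rewrite /E (minn_idPl iN) (minn_idPl jN) /= => ti tj.
    have tab := cell_itv_sub iN ti.
    by move: ti tj; rewrite -!cell_itvE// => /eqP -> /eqP.
  - by rewrite -abE; exact: measurable_int iw.
  - by move=> t; rewrite -abE /= in_itv/= lee_fin => /w0.
rewrite -sumrB (le_trans (ler_norm_sum _ _ _))//.
have -> : c * (b - a) = \sum_(i < n.+1) c * mesh n.
  by rewrite sumr_const card_ord -mulrnAr /mesh -mulr_natr divfK.
apply: ler_sum => i _; have iN := leq_ord i.
have muE : fine (lebesgue_measure (E i)) = mesh n.
  by rewrite ErdE lebesgue_measure_cell.
have mE : measurable (E i) by exact: measurable_itv.
have icst r : (@lebesgue_measure R).-integrable (E i) (EFin \o cst r).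
  apply: (@integrableS _ _ R lebesgue_measure `[a, b] (E i)) => //.
  apply: continuous_compact_integrable; first exact: segment_compact.
  by move=> ?; exact: cst_continuous.
have wE t : E i t -> `|w t - w (midpoint n i)| <= c.
  move=> /[dup] /Esub; rewrite ErdE /= in_itv/= => tab.
  by rewrite -cell_itvE// => /eqP <-; exact: wc.
rewrite ler_norml; apply/andP; split.
  rewrite lerBrDl.
  have -> : mesh n * w (midpoint n i) + - (c * mesh n) =
      \int[lebesgue_measure]_(t in E i) (w (midpoint n i) - c).
    by rewrite Rintegral_cst// muE; ring.
  apply: le_Rintegral => //; first exact: icst.
  by move=> t /wE; rewrite ler_norml => /andP[+ _]; lra.
rewrite lerBlDl.
have -> : mesh n * w (midpoint n i) + c * mesh n =
    \int[lebesgue_measure]_(t in E i) (w (midpoint n i) + c).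
  by rewrite Rintegral_cst// muE; ring.
apply: le_Rintegral => //; first exact: icst.
by move=> t /wE; rewrite ler_norml => /andP[_]; lra.
Qed.

End EqualCells.

(** * Convex and uniformly differentiable functions *)

Section ConvexDifferentiable.
Context {R : realType} {X : vectorLatticeType R} (e : X) (a b : R).
Context (f : R -> X).
Context (e_unit : order_unit e) (a_lt_b : a < b).

Lemma vconvex_midpoint_le t : vconvex a b f -> a <= t <= b ->
  f ((a + b) / 2) <= 2^-1 *: (f t + f (a + b - t)).
Proof.
move=> cf; wlog tm : t / t <= (a + b) / 2 => [hw tab|/andP[at_ tb]].
  have [/hw->//|tm] := leP t ((a + b) / 2).
  have := hw (a + b - t); rewrite subKr [_ + f t]addrC; apply; lra.
move: tm; rewrite le_eqVlt => /predU1P[->|tm].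
  rewrite (_ : a + b - _ = (a + b) / 2); last by lra.
  by rewrite scalerDr -scalerDl (_ : 2^-1 + 2^-1 = 1) ?scale1r//; lra.
have h := cf t ((a + b) / 2) (a + b - t) at_ tm.
apply: le_trans (h _ _) _; [lra|lra|].
rewrite scalerA (_ : _ * _ = 2^-1); last by field; lra.
rewrite scalerBr scalerDr addrCA addrC -[X in X - _ + _]scale1r -scalerBl.
by rewrite (_ : 1 - 2^-1 = 2^-1)//; lra.
Qed.

Lemma vconvex_le_chord t : vconvex a b f -> a < t < b ->
  f t <= f a + ((t - a) / (b - a)) *: (f b - f a).
Proof. by move=> cf /andP[at_ tb]; rewrite -scalerA; exact: cf. Qed.

(** The positions of [t] and [a + b - t] along the chord add up to 1. *)
Lemma vconvex_ends_ge t : vconvex a b f -> a < t < b ->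
  2^-1 *: (f t + f (a + b - t)) <= 2^-1 *: (f a + f b).
Proof.
move=> cf tab; rewrite vler_wpZ2l// ?invr_ge0//.
have tab' : a < a + b - t < b by lra.
apply: le_trans (vleD (vconvex_le_chord cf tab) (vconvex_le_chord cf tab')) _.
rewrite addrACA -scalerDl -mulrDl (_ : _ / _ = 1); last by field; lra.
by rewrite scale1r addrACA subrr addr0.
Qed.

(** The chord bounds [f] from above, also at [a + b - t]; the midpoint inequality
    turns the latter bound into a lower bound of [f] at [t]. *)
Lemma vconvex_bounded : vconvex a b f ->
  exists2 C : R, 0 < C & forall t, a <= t <= b -> vabs (f t) <= C *: e.
Proof.
move=> cf; pose s := vabs (f a) + vabs (f b).
pose m := vabs (f ((a + b) / 2)).
have s0 : 0 <= s by rewrite vaddr_ge0 ?vabs_ge0.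
have upper t : a <= t <= b -> f t <= s.
  move=> /andP[]; rewrite le_eqVlt => /predU1P[<- _|at_].
    by rewrite (le_trans (vle_abs _))// -[leLHS]addr0 vleD2l vabs_ge0.
  rewrite le_eqVlt => /predU1P[->|tb].
    by rewrite (le_trans (vle_abs _))// -[leLHS]add0r vleD2r vabs_ge0.
  have /le_trans -> // := vconvex_le_chord cf (introT andP (conj at_ tb)).
  set c := _ / _; have /andP[c0 c1] : 0 <= c <= 1.
    by rewrite divr_ge0 ?ler_pdivrMr ?mul1r//; lra.
  rewrite scalerBr addrCA addrC -{1}[f a]scale1r -scalerBl.
  apply: vleD; apply: (le_trans (vler_wpZ2l _ (vle_abs _))); rewrite ?subr_ge0//.
    by rewrite -[leRHS]scale1r vler_wpZ2r ?vabs_ge0//; lra.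
  by rewrite -[leRHS]scale1r vler_wpZ2r ?vabs_ge0.
have [C C0 sC] := e_unit.2 (2 *: m + s); exists C => // t tab.
apply: le_trans sC; apply: le_trans (vle_abs _); rewrite vabs_le.
have m0 : 0 <= 2 *: m by rewrite vlat_scaler_ge0 ?vabs_ge0.
apply/andP; split; last by rewrite (le_trans (upper _ tab))// -[leLHS]add0r vleD2r.
have tab' : a <= a + b - t <= b by lra.
have := vconvex_midpoint_le cf tab; rewrite -(@vle_pZ2l _ _ 2)// scalerA mulfV//.
rewrite scale1r -vleBlDr => lo; apply: le_trans lo; rewrite opprD.
apply: vleD; last by rewrite vleN2 upper.
by rewrite -scalerN vler_wpZ2l// -[leRHS]opprK vleN2 vleN_abs.
Qed.

(** The difference quotients over intervals shorter than [delta 0] lie within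
    [sigma 0] of the bounded uniform derivative, and an upper bound of both
    elements of [X] is a multiple of [e]. *)
Lemma uniformly_differentiable_lipschitz : uniformly_differentiable a b f ->
  exists (K d : R), [/\ 0 < K, 0 < d & forall u v, a <= u <= b -> a <= v <= b ->
    `|v - u| < d -> vabs (f v - f u) <= (K * `|v - u|) *: e].
Proof.
move=> [g [[M gM] [sigma [delta [_ delta0 H]]]]].
have [K K0 MK] := e_unit.2 (sigma 0%N + M).
exists K, (delta 0%N); split=> //; first exact: delta0.2.
move=> u v; wlog uv : u v / u <= v => [hw uab vab|].
  have [uv|/ltW vu] := leP u v; first exact: hw.
  by rewrite vabs_distC distrC; exact: hw.
move=> /andP[au ub] /andP[av vb].
move: uv; rewrite le_eqVlt => /predU1P[<-|uv].
  by rewrite !subrr vabs0 normr0 mulr0 scale0r.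
have vu0 : 0 < v - u by rewrite subr_gt0.
rewrite gtr0_norm// => vud; have [s [us _] ssigma] := H 0%N.
rewrite mulrC -scalerA -(@vle_pZ2l _ _ (v - u)^-1) ?invr_gt0//.
rewrite [leRHS]scalerA mulVf ?gt_eqF// scale1r.
rewrite -[X in X *: vabs _](@gtr0_norm _ (v - u)^-1) ?invr_gt0// -vabsZ.
apply: le_trans MK; apply: le_trans (vle_abs _).
rewrite -[X in vabs X](subrK (g u)) (le_trans (vabsD _ _))// vleD//.
  apply: le_trans ssigma; apply: us; exists (u, u, v) => //=; split => //.
    by rewrite lexx ltW.
  by rewrite vu0 ltW.
by apply: gM; rewrite au.
Qed.

End ConvexDifferentiable.

(** * Weighted functions and the inequality *)

Section WeightedProduct.
Context {R : realType} {X : vectorLatticeType R} (e : X) (a b : R).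
Context (f : R -> X) (w : R -> R).

(** The difference is the sum of [w s *: (f s - f t)] and [(w s - w t) *: f t], each
    below [(eps / 2) *: e]. The oscillation of [w] is bounded as well, so that one
    partition serves both the weighted function and the weight. *)
Lemma weighted_unif_continuous (Cw Cf K d0 : R) :
  0 <= e -> 0 < Cw -> 0 < Cf -> 0 < K -> 0 < d0 ->
  (forall t, a <= t <= b -> `|w t| <= Cw) ->
  (forall t, a <= t <= b -> vabs (f t) <= Cf *: e) ->
  (forall u v, a <= u <= b -> a <= v <= b ->
    `|v - u| < d0 -> vabs (f v - f u) <= (K * `|v - u|) *: e) ->
  unif_continuous (w : subspace `[a, b] -> R) ->
  forall eps : R, 0 < eps -> exists2 d : R, 0 < d &
    forall s t, a <= s <= b -> a <= t <= b -> `|s - t| < d ->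
      `|w s - w t| <= eps /\ vabs (w s *: f s - w t *: f t) <= eps *: e.
Proof.
move=> e0 Cw0 Cf0 K0 d00 wC fC fK uw eps eps0.
have eps1 : 0 < Num.min eps (eps / 2 / Cf) by rewrite lt_min eps0 !divr_gt0.
have [d1 d10 wd] := unif_continuous_itvP uw eps1.
exists (Num.min d1 (Num.min d0 (eps / 2 / (Cw * K)))).
  by rewrite !lt_min d10 d00 !divr_gt0// mulr_gt0.
move=> s t sab tab; rewrite !lt_min => /and3P[st1 st0 stK].
have /ltW := wd _ _ sab tab st1; rewrite le_min => /andP[wst wst'].
split=> //.
rewrite (le_trans (vabs_distD (w s *: f t) _ _))//.
rewrite -scalerBr -scalerBl !vabsZ [eps]splitr scalerDl; apply: vleD.
  apply: (le_trans (vler_wpZ2l (normr_ge0 _) (fK _ _ tab sab st0))).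
  rewrite scalerA; apply: vler_wpZ2r => //.
  apply: (@le_trans _ _ (Cw * (K * `|s - t|))).
    by rewrite ler_wpM2r ?wC// mulr_ge0// ltW.
  by rewrite mulrA mulrC -ler_pdivlMr ?mulr_gt0// ltW.
apply: (le_trans (vler_wpZ2l (normr_ge0 _) (fC _ tab))).
rewrite scalerA; apply: vler_wpZ2r => //.
by rewrite -ler_pdivlMr.
Qed.

End WeightedProduct.

(** Reversing the order of the cells pairs each midpoint with its mirror image,
    so a sum with symmetric weights only sees the symmetrization of [f]. *)
Lemma symmetric_midpoint_sum {R : realType} {X : vectorLatticeType R} (a b : R)
    (f : R -> X) (w : R -> R) (n : nat) : a < b ->
  (forall t, a <= t <= b -> w t = w (a + b - t)) ->
  \sum_(i < n.+1) mesh a b n *: (w (midpoint a b n i) *: f (midpoint a b n i)) =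
  \sum_(i < n.+1) (mesh a b n * w (midpoint a b n i)) *:
    (2^-1 *: (f (midpoint a b n i) + f (a + b - midpoint a b n i))).
Proof.
move=> ab ws; set S := LHS.
have SE : S = \sum_(i < n.+1)
    (mesh a b n * w (midpoint a b n i)) *: f (midpoint a b n i).
  by apply: eq_bigr => i _; rewrite scalerA.
have Srev : S = \sum_(i < n.+1)
    (mesh a b n * w (midpoint a b n i)) *: f (a + b - midpoint a b n i).
  rewrite SE (reindex_inj rev_ord_inj)/=; apply: eq_bigr => i _.
  rewrite subSS midpoint_rev ?leq_ord// -ws//.
  by have /andP[/ltW -> /ltW ->] := midpoint_itv ab (leq_ord i).
have -> : S = 2^-1 *: (S + S).
  by rewrite scalerDr -scalerDl (_ : 2^-1 + 2^-1 = 1) ?scale1r//; lra.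
rewrite {1}SE {1}Srev -big_split/= scaler_sumr; apply: eq_bigr => i _.
by rewrite -scalerDr !scalerA mulrC.
Qed.

Theorem theorem4p9 (R : realType) (X : vectorLatticeType R) (e : X)
    (F : set_system nat) (a b : R) (f : R -> X) (w : R -> R)
    (X_complete : dedekind_complete X) (e_unit : order_unit e)
    (F_free : free_filter F) (a_lt_b : a < b)
    (f_diff : uniformly_differentiable a b f) (f_convex : vconvex a b f)
    (w_ge0 : forall t : R, a <= t <= b -> 0 <= w t)
    (w_unif_cont : unif_continuous (w : subspace `[a, b] -> R))
    (w_sym : forall t : R, 0 <= t <= (b - a) / 2 -> w (a + t) = w (b - t)) :
  vintegrable e F `[a, b] (fun t => w t *: f t) /\
  forall I : X, is_integral e F `[a, b] (fun t => w t *: f t) `[a, b] I ->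
    (\int[lebesgue_measure]_(t in `[a, b]) w t) *: f ((a + b) / 2) <= I /\
    I <= (\int[lebesgue_measure]_(t in `[a, b]) w t)
           *: (2^-1 *: (f a + f b)).
Proof.
have e0 : 0 <= e by exact/ltW/e_unit.1.
have Gm := segment_lmeas a b; have Gf := segment_fin a_lt_b.
have wc := unif_continuous_itv_within w_unif_cont.
have [Cw Cw0 wC] : exists2 Cw : R, 0 < Cw & forall t, a <= t <= b -> `|w t| <= Cw.
  have [c cab wle] := EVT_max (ltW a_lt_b) wc.
  exists (1 + w c); first by rewrite ltr_pwDl// w_ge0// -in_itv.
  move=> t tab; rewrite ger0_norm ?w_ge0// (@le_trans _ _ (w c))//.
    by rewrite wle// in_itv.
  by rewrite lerDr.
have [Cf Cf0 fC] := vconvex_bounded e_unit f_convex.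
have [K [d0 [K0 d00 fK]]] := uniformly_differentiable_lipschitz e_unit f_diff.
pose phi t := w t *: f t.
have ws t : a <= t <= b -> w t = w (a + b - t).
  have half s : a <= s <= (a + b) / 2 -> w s = w (a + b - s).
    move=> sab; have := w_sym (s - a).
    rewrite (_ : a + (s - a) = s); last by ring.
    by rewrite (_ : b - (s - a) = a + b - s); [apply; lra|ring].
  move=> tab; have [tm|tm] := leP t ((a + b) / 2); first by apply: half; lra.
  by rewrite [RHS]half ?subKr//; lra.
have mid_ab n i : (i <= n)%N -> a <= midpoint a b n i <= b.
  by move=> /(midpoint_itv a_lt_b)/andP[/ltW -> /ltW ->].
have step eps : 0 < eps -> exists n, forall t, a <= t <= b ->
    `|w t - w (midpoint a b n (cell a b n t))| <= eps /\
    vabs (phi t - midpoint_step a b n phi t) <= eps *: e.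
  move=> eps0; have [d d_gt0 close] := weighted_unif_continuous
    e0 Cw0 Cf0 K0 d00 wC fC fK w_unif_cont eps0.
  have [n nd] := mesh_small a b d_gt0; exists n => t tab.
  apply: close => //; first exact: mid_ab (cell_le a b n t).
  exact: lt_trans (midpoint_step_dist a_lt_b _ tab) nd.
split.
  apply: uniform_limit_vintegrable => // eps /step[n nP].
  exists (midpoint_step a b n phi); first exact: midpoint_step_simple.
  by move=> t /=; rewrite in_itv/= => /nP[].
move=> I intI; set W := \int[_]_(_ in _) _.
(* [W'] and [J] are the midpoint sums of [w] and of [phi]. *)
have bounds eps : 0 < eps -> exists (W' : R) (J : X),
    [/\ `|W - W'| <= eps * (b - a), vabs (I - J) <= (2 * (eps * (b - a))) *: e,
      W' *: f ((a + b) / 2) <= J & J <= W' *: (2^-1 *: (f a + f b))].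
  move=> eps0; have [n nP] := step _ eps0.
  pose h := midpoint_step a b n phi.
  exists (\sum_(i < n.+1) mesh a b n * w (midpoint a b n i)), (simple_int `[a, b] h).
  have weight_ge0 (i : 'I_n.+1) : 0 <= mesh a b n * w (midpoint a b n i).
    by rewrite mulr_ge0 ?w_ge0 ?mid_ab ?leq_ord//; exact/ltW/mesh_gt0.
  split.
  - by apply: midpoint_sum_dist => // t /nP[].
  - have -> : b - a = fine (@completed_lebesgue_measure R `[a, b]).
      by rewrite lebesgue_measure_segment.
    apply: is_integral_dist intI _ _ => //; first exact: midpoint_step_simple.
    by move=> t /=; rewrite in_itv/= => /nP[].
  - rewrite midpoint_step_int// symmetric_midpoint_sum// scaler_suml.
    apply: vler_sum => i _; apply: vler_wpZ2l => //.
    by apply: vconvex_midpoint_le => //; exact/mid_ab/leq_ord.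
  - rewrite midpoint_step_int// symmetric_midpoint_sum// scaler_suml.
    apply: vler_sum => i _; apply: vler_wpZ2l => //.
    by apply: vconvex_ends_ge => //; exact/midpoint_itv/leq_ord.
pose err y := (b - a) *: vabs y + (2 * (b - a)) *: e.
have errE eps y : eps *: err y =
    (eps * (b - a)) *: vabs y + (2 * (eps * (b - a))) *: e.
  by rewrite /err scalerDr !scalerA mulrCA.
split.
  apply: (vle_eps X_complete (z := err (f ((a + b) / 2)))) => eps /bounds.
  move=> [W' [J [WW' IJ lo _]]].
  rewrite (le_trans (vscale_le_dist _ WW'))// errE addrC addrCA vleD2l.
  by rewrite (le_trans lo)// addrC -vleBlDr (le_trans _ IJ)// vabs_distC vle_abs.
apply: (vle_eps X_complete (z := err (2^-1 *: (f a + f b)))) => eps /bounds.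
move=> [W' [J [WW' IJ _ hi]]].
rewrite -[leLHS](subrK J) errE addrA [leRHS]addrC.
apply: vleD; first by rewrite (le_trans (vle_abs _)).
by rewrite (le_trans hi)// vscale_le_dist// distrC.
Qed.
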